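(* Let $P$ be any probability measure on the Borel sets of $\mathbb{R}^d$. Let $\mathcal{V}$ be any family of closed convex sets in $\mathbb{R}^d$, and let $\mathcal{U}=\{V^c: V\in\mathcal{V}\}$ be the family of their complements. Assume that for every $x\in\mathbb{R}^d$ there is a $U\in\mathcal{U}$ with $x\in U$, and that $\lim_{\|x\|\to+\infty}D(x;P,\mathcal{U})=0$. Then $D(x;P,\mathcal{U})>0$ for at least one $x\in\mathbb{R}^d$, and there exists a point $x\in\mathbb{R}^d$ with $D(x;P,\mathcal{U})\ge\frac1{d+1}$.
   Context: The depth function is $D(x;P,\mathcal{U})=\inf\{P(U): x\in U\in\mathcal{U}\}$ for $x\in\mathbb{R}^d$. *)

(* Defs.v *)
From HB Require Import structures.
From mathcomp Require Export all_boot all_order all_algebra.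
From mathcomp Require Export all_classical all_reals all_analysis.

Set Implicit Arguments.
Unset Strict Implicit.
Unset Printing Implicit Defensive.

Import Order.TTheory GRing.Theory Num.Theory.
Import numFieldNormedType.Exports.

Local Open Scope classical_set_scope.
Local Open Scope ring_scope.

(* R^d with its Borel sigma-algebra.  The product topology of ['rV[R]_d] is
   the usual topology of R^d. *)
Definition borel_rV (R : realType) (d : nat) :=
  g_sigma_algebraType (@open 'rV[R]_d).

(* The library norm [`|x|] on row vectors is the max norm. *)
Definition enorm (R : realType) (d : nat) (x : 'rV[R]_d) : R :=
  Num.sqrt (\sum_(i < d) x ord0 i ^+ 2).

(* The filter "||x|| tends to +oo"; it is improper exactly when d = 0. *)
Definition enorm_pinfty (R : realType) (d : nat) : set_system 'rV[R]_d :=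
  filter_from [set: R] (fun M => [set x | M < enorm x]).

Global Instance enorm_pinfty_filter (R : realType) (d : nat) :
  Filter (@enorm_pinfty R d).
Proof.
apply: filter_from_filter; first by exists 0.
move=> M N _ _; exists (Num.max M N) => // x /=.
by rewrite gt_max => /andP[].
Qed.

Arguments enorm_pinfty R d : clear implicits.

Definition depth (R : realType) (d : nat)
    (P : probability (borel_rV R d) R) (U : set (set 'rV[R]_d))
    (x : 'rV[R]_d) : \bar R :=
  ereal_inf [set P A | A in [set A | U A /\ A x]].

(* Main.v *)
Require Import Defs.
From mathcomp Require Import all_boot all_order all_algebra.
From mathcomp Require Import finmap.
From mathcomp Require Import all_classical all_reals all_analysis.
From mathcomp Require Import lra.

(** Write [a = 1 / (d + 1)] and suppose that the depth is below [a] everywhere.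
    Then every point lies in an open [A] of [U] with [P A < a] whose complement
    is convex.

    These measures can be bounded by a single [b < a]
    ([uniform_light_neighborhood]): by compactness on a large ball, and because
    the depth tends to zero outside it. Since [1 - (d + 1) b > 0], there is a
    ball [B] whose complement has measure less than [1 - (d + 1) b] ([tight]).
    By subadditivity, any [d + 1] of the sets [A], together with the complement
    of [B], have total measure less than [1], so the complements of these sets
    have a common point in [B].

    Finitely many of the sets [A] cover the compact ball [B]. Their complements,
    intersected with [B], are convex and any [d + 1] of them meet, so by Helly's
    theorem ([helly]) all of them meet: some point of [B] is not covered, a
    contradiction.

    A point of depth at least [a] has positive depth, which gives the first
    assertion. *)

Import Order.TTheory GRing.Theory Num.Theory.
Import numFieldNormedType.Exports.

Local Open Scope classical_set_scope.
Local Open Scope ring_scope.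

(** * Convex sets and Helly's theorem *)

Lemma convex_set_conv (R : numDomainType) (M : lmodType R) (A : set M)
    (x y : M) (t : R) :
  @convex_set R M A -> A x -> A y -> 0 <= t -> t <= 1 ->
  A (t *: x + (1 - t) *: y).
Proof.
move=> cA Ax Ay t0 t1.
by have := cA x y (Itv01 t0 t1); rewrite !inE; apply.
Qed.

Lemma convex_setI (R : numDomainType) (M : lmodType R) (A B : set M) :
  @convex_set R M A -> @convex_set R M B -> @convex_set R M (A `&` B).
Proof.
move=> cA cB x y t /set_mem[Ax Bx] /set_mem[Ay By].
by apply: mem_set; split; apply: set_mem; [apply: cA|apply: cB]; exact: mem_set.
Qed.

(** Induction on the sum works because it keeps track only of the total weight
    [s] and of one point [a] carrying that weight; merging two such pairs is a
    single binary convex combination. *)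
Lemma convex_set_barycenter (R : numFieldType) (M : lmodType R) (A : set M)
    (I : finType) (S : pred I) (w : I -> R) (x : I -> M) :
  @convex_set R M A -> (forall i, S i -> 0 <= w i) ->
  (forall i, S i -> A (x i)) -> 0 < \sum_(i | S i) w i ->
  A ((\sum_(i | S i) w i)^-1 *: \sum_(i | S i) w i *: x i).
Proof.
move=> cA w0 Ax.
(* While the total weight is zero, [a] is an arbitrary point, perhaps outside
   [A]. *)
pose K (s : R) (v : M) := 0 <= s /\ exists2 a, 0 < s -> A a & v = s *: a.
have : K (\sum_(i | S i) w i) (\sum_(i | S i) w i *: x i).
  apply: (big_ind2 K).
  - by split=> //; exists 0; rewrite ?ltxx ?scale0r.
  - move=> s1 _ s2 _ [s1_ge0 [a1 Aa1 ->]] [s2_ge0 [a2 Aa2 ->]].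
    split; first exact: addr_ge0.
    have [s1_gt0|] := boolP (0 < s1); last first.
      rewrite lt0r s1_ge0 andbT negbK => /eqP ->.
      by exists a2; rewrite add0r ?scale0r ?add0r.
    have [s2_gt0|] := boolP (0 < s2); last first.
      rewrite lt0r s2_ge0 andbT negbK => /eqP ->.
      by exists a1; rewrite addr0 ?scale0r ?addr0.
    have s_gt0 : 0 < s1 + s2 by exact: addr_gt0.
    have sN0 : s1 + s2 != 0 by rewrite gt_eqF.
    exists ((s1 / (s1 + s2)) *: a1 + (1 - s1 / (s1 + s2)) *: a2) => [_|].
      apply: convex_set_conv (Aa1 _) (Aa2 _) _ _ => //.
        by rewrite divr_ge0// ltW.
      by rewrite ler_pdivrMr// mul1r lerDl.
    rewrite scalerDr !scalerA mulrBr mulr1 mulrCA divff// mulr1.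
    by rewrite addrAC subrr add0r.
  - by move=> i Si; split; [exact: w0|exists (x i) => // _; exact: Ax].
move=> [_ [a Aa ->]] s_gt0.
by rewrite scalerA mulVf ?gt_eqF// scale1r; apply: Aa.
Qed.

(** The vectors [(1, x i)] live in dimension [d + 1], so more than [d + 1] of
    them are linearly dependent; the first coordinate of the relation says that
    the weights sum to zero. *)
Lemma affine_dependence (F : fieldType) (d : nat) (I : finType) (S : {set I})
    (x : I -> 'rV[F]_d) :
  (d.+1 < #|S|)%N ->
  exists w : I -> F, [/\ exists2 i, i \in S & w i != 0,
    \sum_(i in S) w i = 0 & \sum_(i in S) w i *: x i = 0].
Proof.
move=> ltdS.
have /card_gt0P[i0 Si0] : (0 < #|S|)%N by exact: leq_trans ltdS.
pose X := \matrix_(k < #|S|) row_mx (1 : 'rV[F]_1) (x (enum_val k)).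
have : kermx X != 0.
  rewrite kermx_eq0; apply/negP => /eqP rX.
  by have := rank_leq_col X; rewrite rX leqNgt ltdS.
move=> /matrix0Pn[r [k ker_rk]].
pose v := row r (kermx X).
have vX : v *m X = 0 by apply/sub_kermxP; exact: row_sub.
pose w i := v ord0 (enum_rank_in Si0 i).
have wE (j : 'I_#|S|) : w (enum_val j) = v ord0 j by rewrite /w enum_valK_in.
have sumX : \sum_(i in S) w i *: row_mx (1 : 'rV[F]_1) (x i) = 0.
  rewrite -[RHS]vX mulmx_sum_row [LHS]big_enum_val.
  by apply: eq_bigr => j _; rewrite wE rowK.
exists w; split.
- by exists (enum_val k); [exact: enum_valP|rewrite wE mxE].
- have := congr1 (fun m => lsubmx m ord0 ord0) sumX.
  rewrite linear_sum summxE /= linear0 mxE; apply: etrans.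
  by apply: eq_bigr => i _; rewrite linearZ /= row_mxKl !mxE mulr1.
- have := congr1 rsubmx sumX.
  rewrite linear_sum linear0; apply: etrans.
  by apply: eq_bigr => i _; rewrite linearZ /= row_mxKr.
Qed.

(** Helly's theorem, by induction on the size of the subfamily [S]. If [S] has
    more than [d + 1] members, pick for each [i] a point [x i] common to all
    members but the [i]-th. Radon's argument applies to these points: splitting
    an affine dependence [w] by sign gives one point [p] that is at once a
    barycenter of the [x i] with [w i > 0] and of those with [w i <= 0].
    Whatever the sign of [w j], one of these two descriptions avoids [x j], so
    all the points it uses, and therefore [p], lie in [C j]. *)
Lemma helly (R : realFieldType) (d : nat) (I : finType)
    (C : I -> set 'rV[R]_d) :
  (forall i, @convex_set R 'rV[R]_d (C i)) ->
  (forall S : {set I},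
    (#|S| <= d.+1)%N -> \bigcap_(i in [set` S]) C i !=set0) ->
  \bigcap_i C i !=set0.
Proof.
move=> cC small.
suff all_S n : forall S : {set I}, (#|S| <= n)%N ->
    \bigcap_(i in [set` S]) C i !=set0.
  have [p Cp] := all_S _ [set: I]%SET (leqnn _).
  by exists p => i _; apply: Cp; rewrite /= inE.
elim: n => [|n IHn] S leSn; first by apply: small; rewrite (leq_trans leSn).
have [/small//|ltdS] := leqP #|S| d.+1.
have /choice[x Cx] : forall i, exists p,
    i \in S -> forall j, j \in S -> j != i -> C j p.
  move=> i; have [Si|] := boolP (i \in S); last by exists 0.
  have [|p Cp] := IHn (S :\ i)%SET.
    by rewrite -ltnS; move: leSn; rewrite (cardsD1 i) Si.
  by exists p => _ j Sj ji; apply: Cp; rewrite /= !inE ji.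
have [w [[i0 Si0 wi0] sum_w sum_wx]] := affine_dependence _ _ _ _ x ltdS.
pose W := \sum_(i in S | 0 < w i) w i.
pose p := W^-1 *: \sum_(i in S | 0 < w i) w i *: x i.
have W_neg : \sum_(i in S | ~~ (0 < w i)) - w i = W.
  move: sum_w; rewrite (bigID (fun i => 0 < w i)) /= -/W sumrN => /eqP.
  by rewrite addr_eq0 => /eqP.
have p_neg : p = W^-1 *: \sum_(i in S | ~~ (0 < w i)) (- w i) *: x i.
  congr (_ *: _); move: sum_wx; rewrite (bigID (fun i => 0 < w i)) /=.
  move/eqP; rewrite addr_eq0 => /eqP ->; rewrite -sumrN.
  by apply: eq_bigr => i _; rewrite scaleNr.
have W_gt0 : 0 < W.
  have W_ge0 : 0 <= W by apply: sumr_ge0 => i /andP[_ /ltW].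
  rewrite lt0r W_ge0 andbT; apply: contra wi0 => W0.
  have [w_gt0|w_le0] := ltP 0 (w i0).
    move: W0; rewrite psumr_eq0 => [|i /andP[_ /ltW]//].
    by move=> /allP/(_ i0 (mem_index_enum _)); rewrite Si0 w_gt0.
  move: W0; rewrite -W_neg psumr_eq0 => [|i /andP[_]]; last first.
    by rewrite -leNgt oppr_ge0.
  move=> /allP/(_ i0 (mem_index_enum _)).
  by rewrite Si0 -leNgt w_le0 oppr_eq0.
exists p => j /= Sj.
have [wj_gt0|wj_le0] := ltP 0 (w j).
  rewrite p_neg -W_neg; apply: convex_set_barycenter (cC j) _ _ _.
  - by move=> i /andP[_]; rewrite -leNgt oppr_ge0.
  - move=> i /andP[Si wi]; apply: Cx => //.
    by apply: contraNneq wi => <-.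
  - by rewrite W_neg.
apply: convex_set_barycenter (cC j) _ _ W_gt0.
- by move=> i /andP[_ /ltW].
- move=> i /andP[Si wi]; apply: Cx => //.
  by apply: contraTneq wi => <-; rewrite -leNgt.
Qed.

(** * Balls and Borel measures on row vectors *)

Section Euclidean.
Context {R : realType} {d : nat}.

(** The norm of a row vector is its max norm, against which boundedness and
    compactness are expressed; hence these balls are not Euclidean. *)
Definition maxball (r : R) : set 'rV[R]_d := [set x | `|x| <= r].

Lemma closed_maxball r : closed (maxball r).
Proof.
apply: (@preimage_closed 'rV[R]_d R^o (fun x => `|x|) [set y | y <= r]).
  by move=> x _; exact: norm_continuous.
exact: closed_le.
Qed.

Lemma compact_maxball r : compact (maxball r).
Proof.
apply: bounded_closed_compact; last exact: closed_maxball.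
exists r; split; first exact: num_real.
by move=> s rs x /= xr; rewrite (le_trans xr)// ltW.
Qed.

Lemma convex_maxball r : @convex_set R 'rV[R]_d (maxball r).
Proof.
move=> x y t /set_mem /= xr /set_mem /= yr; apply: mem_set => /=.
have t0 : 0 <= t%:num by [].
have t1 : 0 <= 1 - t%:num by rewrite subr_ge0.
apply: (le_trans (ler_normD _ _)).
rewrite !normrZ (ger0_norm t0) (ger0_norm t1).
rewrite (le_trans (lerD (ler_wpM2l t0 xr) (ler_wpM2l t1 yr)))//.
by rewrite -mulrDl addrC subrK mul1r.
Qed.

(** Turns a statement about points of large Euclidean norm into one about the
    complement of a [maxball]. *)
Lemma maxnorm_le_enorm (x : 'rV[R]_d) : `|x| <= enorm x.
Proof.
have e0 : 0 <= enorm x by exact: sqrtr_ge0.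
rewrite [leLHS]mx_normrE; apply/bigmax_leP; split=> // -[i j] _ /=.
rewrite (ord1 i) /enorm -sqrtr_sqr ler_wsqrtr// (bigD1 j)//= lerDl.
by apply: sumr_ge0 => k _; exact: sqr_ge0.
Qed.

Lemma borel_open (A : set 'rV[R]_d) :
  open A -> measurable (A : set (borel_rV R d)).
Proof. exact: sub_sigma_algebra. Qed.

Lemma borel_closed (A : set 'rV[R]_d) :
  closed A -> measurable (A : set (borel_rV R d)).
Proof.
move=> cA; rewrite -[A]setCK; apply: measurableC; apply: borel_open.
exact: closed_openC.
Qed.

(** Continuity from below of [P] along the balls of integer radius, which
    exhaust the space. *)
Lemma tight (P : probability (borel_rV R d) R) (e : R) : 0 < e ->
  exists r, (P (~` maxball r) < e%:E)%E.
Proof.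
move=> e0.
have mB n : measurable (maxball n%:R : set (borel_rV R d)).
  exact: borel_closed (closed_maxball _).
have BT : \bigcup_n (maxball n%:R) = [set: 'rV[R]_d].
  rewrite -subTset => x _; exists (Num.truncn `|x|).+1 => //=.
  by rewrite /maxball /= ltW// truncnS_gt.
have : (fun n => P (maxball n%:R)) @ \oo --> P (\bigcup_n (maxball n%:R)).
  apply: nondecreasing_cvg_mu => //.
    by apply: bigcup_measurable => n _; exact: mB.
  move=> m n mn; apply/subsetPset => x /= /le_trans; apply.
  by rewrite ler_nat.
rewrite BT probability_setT => /(_ [set y | ((1 - e)%:E < y)%E]) [].
  apply: open_nbhs_nbhs; split; first exact: open_ereal_gt_ereal.
  by rewrite /= lte_fin gtrBl.
move=> n _ /(_ n (leqnn _)) /= ltP; exists n%:R.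
rewrite probability_setC//.
rewrite -(fineK (fin_num_measure P _ (mB n))) in ltP *.
by move: ltP; rewrite -EFinB !lte_fin => ?; lra.
Qed.

End Euclidean.

Lemma measure_bigsetU_le (dd : measure_display) (T : measurableType dd)
    (R : realType) (mu : {measure set T -> \bar R}) (I : finType) (S : pred I)
    (A : I -> set T) (c : \bar R) :
  (forall i, measurable (A i)) -> (forall i, S i -> (mu (A i) <= c)%E) ->
  (mu (\big[setU/set0]_(i | S i) A i) <= \sum_(i | S i) c)%E.
Proof.
move=> mA Ac.
pose K (B : set T) (s : \bar R) := measurable B /\ (mu B <= s)%E.
suff [] : K (\big[setU/set0]_(i | S i) A i) (\sum_(i | S i) c)%E by [].
apply: (big_ind2 K) => [|B s B' s' [mB Bs] [mB' Bs']|i Si].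
- by split; [exact: measurable0|rewrite measure0].
- split; first exact: measurableU.
  by apply: le_trans (measureU2 _ mB mB') _; exact: leeD.
- by split; [exact: mA|exact: Ac].
Qed.

(** * The depth function *)

(** If the depth is everywhere below [a], it is so uniformly. Depth is upper
    semicontinuous: an open set witnessing [depth x < a] also witnesses it at
    all its points. Hence finitely many witnesses serve a whole ball, and their
    largest measure is still below [a]. Outside a suitable ball the depth is
    below [a / 2], since it vanishes at infinity. This is the only use of the
    behaviour at infinity. *)
Lemma uniform_light_neighborhood (R : realType) (d : nat)
    (P : probability (borel_rV R d) R) (U : set (set 'rV[R]_d)) (a : R) :
  (forall A, U A -> open A) -> 0 < a ->
  depth P U x @[x --> enorm_pinfty R d] --> 0%E ->
  (forall x, (depth P U x < a%:E)%E) ->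
  exists2 b, b < a & forall x, exists A, [/\ U A, A x & (P A <= b%:E)%E].
Proof.
move=> oU a0 /(_ [set y | (y < (a / 2)%:E)%E]) far lta.
have finP A : U A -> P A \is a fin_num.
  by move=> UA; exact: fin_num_measure (borel_open _ (oU _ UA)).
have [|M _ M_far] := far.
  apply: open_nbhs_nbhs; split; first exact: open_ereal_lt_ereal.
  by rewrite /= lte_fin divr_gt0.
have /choice[A Ax] : forall x, exists A, [/\ U A, A x & (P A < a%:E)%E].
  move=> x; have /ereal_inf_ltP[_ [A [UA Ax] <-] PA] := lta x.
  by exists A.
have := @compact_maxball R d M; rewrite compact_cover.
move=> /(_ _ [set: 'rV[R]_d] A)[x _|x _|D _ coverD].
- by have [/oU] := Ax x.
- by exists x => //; have [] := Ax x.
(* The starting value [a / 2] of the maximum takes care of the points outside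
   the ball. *)
exists (\big[Num.max/a / 2]_(c <- D) fine (P (A c))).
  apply: bigmax_lt => [|c _]; first by rewrite ltr_pdivrMr// ltr_pMr// ltr1n.
  by have [UA _] := Ax c; rewrite -lte_fin fineK ?finP.
move=> x; have [xM|Mx] := leP `|x| M.
  have [c /= Dc Acx] := coverD x xM.
  have [UA _ _] := Ax c.
  exists (A c); split=> //.
  by rewrite -[leLHS]fineK ?finP// lee_fin;
    exact: (le_bigmax_seq _ _ _ (fun c => fine (P (A c))) Dc).
have /ereal_inf_ltP[_ [B [UB Bx] <-] PB] :=
  M_far x (lt_le_trans Mx (maxnorm_le_enorm x)).
exists B; split=> //; apply: le_trans (ltW PB) _.
by rewrite lee_fin bigmax_ge_id.
Qed.

Theorem theorem5p1 (R : realType) (d : nat)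
    (P : probability (borel_rV R d) R)
    (V U : set (set 'rV[R]_d))
    (V_closed : forall C, V C -> closed C)
    (V_convex : forall C, V C -> @convex_set R 'rV[R]_d C)
    (U_def : U = [set ~` C | C in V])
    (U_cover : forall x : 'rV[R]_d, exists2 A, U A & A x)
    (depth_cvg0 : depth P U x @[x --> enorm_pinfty R d] --> 0%E) :
  (exists x : 'rV[R]_d, (0 < depth P U x)%E) /\
  (exists x : 'rV[R]_d, ((d.+1%:R^-1)%:E <= depth P U x)%E).
Proof.
have d1_gt0 : 0 < d.+1%:R^-1 :> R by rewrite invr_gt0 ltr0n.
suff [x deep] : exists x, ((d.+1%:R^-1)%:E <= depth P U x)%E.
  by split; exists x => //; apply: lt_le_trans deep; rewrite lte_fin.
have oU A : U A -> open A.
  by rewrite U_def => -[C /V_closed cC <-]; exact: closed_openC.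
apply: contrapT => /forallNP shallow.
have {shallow}lt_d1 x : (depth P U x < (d.+1%:R^-1)%:E)%E.
  by rewrite ltNge; apply/negP; exact: shallow.
have [b b_lt light] :=
  uniform_light_neighborhood _ _ _ _ _ oU d1_gt0 depth_cvg0 lt_d1.
have /choice[A Ax] := light.
have gap : 0 < 1 - d.+1%:R * b.
  by rewrite subr_gt0 mulrC -ltr_pdivlMr ?ltr0n// mul1r.
(* Any [d + 1] of the sets [A x] leave at least [1 - (d + 1) b] of the mass
   uncovered; if a ball misses less than that, some uncovered point is in it. *)
have [r Br] := tight P _ gap.
have b_ge0 : 0 <= b.
  by have [_ _ /(le_trans (measure_ge0 P _))] := Ax 0; rewrite lee_fin.
have := @compact_maxball R d r; rewrite compact_cover.
move=> /(_ _ [set: 'rV[R]_d] A)[x _|x _|D _ coverD].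
- by have [/oU] := Ax x.
- by exists x => //; have [] := Ax x.
have mA x : measurable (A x : set (borel_rV R d)).
  by have [/oU/borel_open] := Ax x.
have mB : measurable (~` maxball r : set (borel_rV R d)).
  exact: measurableC (borel_closed _ (closed_maxball r)).
have few_meet (S : {set D}) : (#|S| <= d.+1)%N ->
    exists2 p, maxball r p & forall c, c \in S -> ~ A (fsval c) p.
  move=> leS; apply: contrapT => disj.
  pose N : set (borel_rV R d) := \big[setU/set0]_(c in S) A (fsval c).
  have mN : measurable N by apply: bigsetU_measurable => c _; exact: mA.
  have TN : [set: borel_rV R d] `<=` ~` maxball r `|` N.
    move=> p _; apply: contrapT => /not_orP[/contrapT Bp Np].
    apply: disj; exists p => // c Sc Acp; apply: Np.
    by rewrite /N -bigcup_pred; exists c.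
  have PN : (P N <= (d.+1%:R * b)%:E)%E.
    apply: (@le_trans _ _ (\sum_(c in S) b%:E)%E).
      apply: (measure_bigsetU_le _ _ _ _ _ _ _ _ (fun c => mA (fsval c))).
      move=> c _.
      by have [] := Ax (fsval c).
    rewrite sumEFin lee_fin sumr_const -[leLHS]mulr_natl.
    by apply: ler_wpM2r => //; rewrite ler_nat.
  have : (P [set: borel_rV R d] < 1)%E.
    apply: le_lt_trans (le_measure P (mem_set measurableT)
      (mem_set (measurableU _ _ mB mN)) TN) _.
    apply: le_lt_trans (measureU2 _ mB mN) _.
    rewrite (_ : 1%E = ((1 - d.+1%:R * b)%:E + (d.+1%:R * b)%:E)%E); last first.
      by rewrite -EFinD subrK.
    by apply: lte_leD => //; exact: fin_num_measure.
  by rewrite probability_setT ltxx.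
pose C (c : D) := ~` A (fsval c) `&` maxball r.
have cC c : @convex_set R 'rV[R]_d (C c).
  have [UA _ _] := Ax (fsval c).
  move: UA; rewrite U_def /C => -[W VW <-]; rewrite setCK.
  by apply: convex_setI; [exact: V_convex|exact: convex_maxball].
have [S leS|p Cp] := helly R d _ C cC.
  have [p Bp Ap] := few_meet S leS.
  by exists p => c /= Sc; split=> //; exact: Ap.
(* If [D] were empty, the point [p] given by Helly's theorem would be
   unconstrained; a point [q] of the ball, which the cover must reach, shows
   that [D] is inhabited, hence that [p] is in the ball. *)
have [|q Bq _] := few_meet finset.set0; first by rewrite cards0.
have [c0 /= Dc0 _] := coverD q Bq.
have [_ Bp] := Cp [` Dc0]%fset I.
have [c /= Dc Acp] := coverD p Bp.
by have [] := Cp [` Dc]%fset I.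
Qed.
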